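(* Let $\Gamma$ be a compact smooth surface with reach $r_\Gamma>0$, and let $K_\Gamma$ be the maximum over $\Gamma$ of the absolute values of the principal curvatures. If $h$ is sufficiently small, then every cut tetrahedron of the adjusted mesh $\mathcal T_h$ (obtained from an initial mesh of size $h$ by the vertex displacement procedure defined in the context) is consistent with $\Gamma$. The same assertion holds in two dimensions: for a compact smooth curve, every cut triangle of the adjusted triangular mesh is consistent with the curve if $h$ is sufficiently small.
   Context: $\Gamma=\{F=0\}\subset\mathbb{R}^m$, $m=3$ (surface) or $m=2$ (curve), is a compact smooth regular level set ($\nabla F\neq0$ on $\Gamma$). The reach $r_\Gamma$ is the supremum of all $r>0$ such that every $x$ with $\operatorname{dist}(x,\Gamma)<r$ has a unique closest point on $\Gamma$. For a curve, $K_\Gamma$ is the maximum absolute curvature. $d$ is the signed distance to $\Gamma$, and $\pi_\Gamma$ and $n=\nabla d$ are the closest-point projection and unit normal near $\Gamma$. Initial meshes $\mathcal T_h^0$ of a convex computational box are conforming, simplicial, shape-regular and quasi-uniform with mesh size $h$: $c_{\rm m}h\le h_T\le C_{\rm m}h$, $h_T=\operatorname{diam}(T)$, constants independent of $h$. Vertex displacement: with a fixed, sufficiently small $\rho>0$ independent of $h$ ($0<\rho\le\rho_*$ with $\rho_*$ depending only on the shape-regularity and quasi-uniformity constants), for each vertex $a$ set $\widetilde a=a$ if $|d(a)|\ge\rho h$ and $\widetilde a=\pi_\Gamma(a)+\operatorname{sign}(d(a))\rho h\,n(\pi_\Gamma(a))$ if $|d(a)|<\rho h$ (if $d(a)=0$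 a sign $\pm1$ is assigned by convention). $\mathcal T_h$ has vertices $\widetilde a$ and the same connectivity. A simplex $T\in\mathcal T_h$ is cut if $T\cap\Gamma\ne\emptyset$. A simplex $T$ is consistent with $\Gamma$ if $h_T<r_\Gamma$, $h_TK_\Gamma\le\frac14$, and, for a constant $c_0>0$ independent of $h_T$, every vertex $a$ of $T$ satisfies $\operatorname{dist}(a,\Gamma)>\max\{c_0h_T,K_\Gamma h_T^2\}$. *)

(* Defs.v *)
From HB Require Import structures.
From mathcomp Require Import all_boot all_order all_algebra.
From mathcomp Require Import boolp classical_sets functions reals ereal topology.
From mathcomp Require Import normedtype derive.

Set Implicit Arguments.
Unset Strict Implicit.
Unset Printing Implicit Defensive.

Import Order.TTheory GRing.Theory Num.Theory.
Import numFieldNormedType.Exports.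
Local Open Scope classical_set_scope.
Local Open Scope ring_scope.

Section Euclidean.
Context {R : realType} {m : nat}.
Local Notation Rm := 'rV[R]_m.
Implicit Types (u v x y : Rm) (A : set Rm).

(* The library norm `|_| on 'rV[R]_m is the sup norm; lengths, distances and
   diameters below are Euclidean. The two norms induce the same topology, so
   compactness and differentiability are those of the library. *)
Definition dot u v : R := \sum_i u 0 i * v 0 i.
Definition enorm u : R := Num.sqrt (dot u u).
Definition dist x A : R := inf [set enorm (x - y) | y in A].
Definition ediam A : R := sup [set enorm (p.1 - p.2) | p in A `*` A].

(* Diameter of the largest closed Euclidean ball contained in A. *)
Definition inball_diam A : R :=
  sup [set 2 * r | r in [set r | 0 <= r /\
         exists c, [set x | enorm (x - c) <= r] `<=` A]].

Definition grad (f : Rm -> R) x : Rm := \row_i 'D_(delta_mx 0 i) f x.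

Definition partials (f : Rm -> R) (s : seq 'I_m) : Rm -> R :=
  foldr (fun i g x => 'D_(delta_mx 0 i) g x) f s.

(* C^oo: a differentiable function is continuous, so all iterated partial
   derivatives exist and are continuous. *)
Definition smooth (f : Rm -> R) : Prop :=
  forall (s : seq 'I_m) x, differentiable (partials f s) x.

Definition closest A x y : Prop :=
  A y /\ forall z, A z -> enorm (x - y) <= enorm (x - z).

(* Meaningful wherever the closest point exists and is unique. *)
Definition proj A x : Rm := get (closest A x).

(* Extended-real valued: the supremum may be +oo, and it is -oo when no radius
   qualifies (in particular for A = set0). *)
Definition reach A : \bar R :=
  ereal_sup [set r%:E | r in [set r : R | 0 < r /\
    forall x, dist x A < r -> exists! y, closest A x y]].

End Euclidean.

Section LevelSet.
Context {R : realType} {m : nat}.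
Local Notation Rm := 'rV[R]_m.
Variable F : Rm -> R.

Definition level_set : set Rm := [set x | F x = 0].
Definition regular : Prop := forall x, level_set x -> grad F x != 0.

(* Oriented by F: positive where F > 0, negative where F < 0. *)
Definition sdist (x : Rm) : R := Num.sg (F x) * dist x level_set.

Definition normal (x : Rm) : Rm := grad sdist x.

(* Eigenvalues of the shape operator v |-> D_v n on the tangent space of the
   level set (the orthogonal complement of n). *)
Definition principal_curvatures : set R :=
  [set k | exists p v : Rm, [/\ level_set p, v != 0, dot v (normal p) = 0 &
                                'D_v normal p = k *: v]].

Definition arclength_param (g : R -> Rm) : Prop :=
  forall t, [/\ level_set (g t), forall k, derivable (derive1n k g) t 1 &
                enorm (derive1 g t) = 1].

Definition curve_abs_curvatures : set R :=
  [set enorm (derive1n 2 p.1 p.2) | p in [set p : (R -> Rm) * R | arclength_param p.1]].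

(* For a compact smooth regular level set the set is bounded and its supremum
   is attained, so this is the maximum. The case m = 2 is that of curves. *)
Definition Kmax : R :=
  sup (if m == 2%N then curve_abs_curvatures
       else [set `|k| | k in principal_curvatures]).

(* The boolean s selects the sign used when the signed distance vanishes. *)
Definition dsign (s : bool) (a : Rm) : R :=
  if sdist a == 0 then (-1) ^+ s else Num.sg (sdist a).

Definition displace (rho h : R) (s : bool) (a : Rm) : Rm :=
  if rho * h <= `|sdist a| then a
  else let p := proj level_set a in p + (dsign s a * (rho * h)) *: normal p.

End LevelSet.

(* A mesh is given by a finite type V of vertices, their positions x, and a set
   of vertex sets of cardinal m + 1 (the connectivity). *)
Section Mesh.
Context {R : realType} {m : nat} {V : finType}.
Local Notation Rm := 'rV[R]_m.
Implicit Types (x : V -> Rm) (t : {set V}) (T : {set {set V}}).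

Definition hull x t : set Rm :=
  [set y | exists w : V -> R, [/\ forall v, 0 <= w v, \sum_(v in t) w v = 1 &
                                  y = \sum_(v in t) w v *: x v]].

(* Positions affinely independent, as well as m + 1 vertices. *)
Definition is_simplex x t : Prop :=
  #|t| = m.+1 /\
  forall w : V -> R, \sum_(v in t) w v = 0 -> \sum_(v in t) w v *: x v = 0 ->
    forall v, v \in t -> w v = 0.

Definition diamT x t : R := ediam (hull x t).

Definition box (lo up : Rm) : set Rm :=
  [set y | forall i, lo 0 i <= y 0 i <= up 0 i].

Record initial_mesh (lo up : Rm) (sigma cm Cm h : R) x T : Prop := InitialMesh {
  mesh_simplex : forall t, t \in T -> is_simplex x t;
  mesh_vertex : forall v, exists2 t, t \in T & v \in t;
  mesh_cover : \bigcup_(t in [set` T]) hull x t = box lo up;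
  mesh_conforming : forall t t', t \in T -> t' \in T ->
    hull x t `&` hull x t' = hull x (t :&: t');
  mesh_shape_regular : forall t, t \in T ->
    diamT x t <= sigma * inball_diam (hull x t);
  mesh_quasi_uniform : forall t, t \in T -> cm * h <= diamT x t <= Cm * h
}.

Definition adjusted (F : Rm -> R) (rho h : R) (s : V -> bool) x : V -> Rm :=
  fun v => displace F rho h (s v) (x v).

Definition cut (F : Rm -> R) x t : Prop := hull x t `&` level_set F !=set0.

Record consistent (F : Rm -> R) (c0 : R) x t : Prop := Consistent {
  consistent_simplex : is_simplex x t;
  consistent_reach : ((diamT x t)%:E < reach (level_set F))%E;
  consistent_curvature : diamT x t * Kmax F <= 4^-1;
  consistent_vertices : forall v, v \in t ->
    Num.max (c0 * diamT x t) (Kmax F * diamT x t ^+ 2) < dist (x v) (level_set F)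
}.

End Mesh.

(* Main.v *)
Require Import Defs.
From HB Require Import structures.
From mathcomp Require Import all_boot all_order all_algebra.
From mathcomp Require Import boolp classical_sets functions reals ereal topology.
From mathcomp Require Import normedtype derive.
From mathcomp Require Import ring lra.

Set Implicit Arguments.
Unset Strict Implicit.
Unset Printing Implicit Defensive.

Import Order.TTheory GRing.Theory Num.Theory.
Import numFieldNormedType.Exports.
Local Open Scope classical_set_scope.
Local Open Scope ring_scope.

(** Put G = |grad F p| at a point p of the level set Gamma. Since F is C^1 and
regular, it is strictly differentiable at p, so F varies like a linear form of
norm G near p. This gives (G - e) dist(x, Gamma) <= |F x| <= (G + e) dist(x, Gamma)
for x close to p: the right inequality because F is (G + e)-Lipschitz there and
vanishes on Gamma, the left one because, walking from x along the direction of
-sign(F x) grad F p, |F| decreases at rate at least G - e, hence F has a zero at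
distance at most |F x| / (G - e). Two consequences carry the proof.

The signed distance agrees to first order with F / G at p, so the normal n, that
is the gradient of the signed distance, is grad F p / G and has length one
([normal_level]). In particular displacing a vertex moves it by at most 2 rho h
([displace_near]).

Moreover |F (q + t n(q))| is about G |t| for q on Gamma close to p, whence
dist(q + t n(q), Gamma) >= |t| / 2 for small t. Compactness of Gamma makes the
bound on t uniform in q ([offset_dist]), so once h is small every adjusted vertex
is at distance at least rho h / 2 from Gamma ([displace_far]).

It remains to control the shape of the adjusted simplices. Their diameters are at
most (Cm + 4 rho) h, so all conditions on the diameter hold for h small, with
c0 = rho / (4 (Cm + 4 rho)). For affine independence, the original simplex contains
a ball of radius r proportional to h. If the weights w have zero sum, moving the
centre of this ball by r in the direction of u = \sum w_v x_v changes
the barycentric coordinates by multiples of the w_v but keeps them in [0, 1];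
hence |w_v| r <= |u| ([bary_weight_bound]). A relation between the adjusted
vertices with weights w makes |u| at most 2 rho h \sum |w_v|, which forces
u = 0 when rho is small, so w = 0 ([is_simplex_perturb]). *)

(** * Euclidean length and distance to a set *)

Section EuclideanSpace.
Context {R : realType} {m : nat}.
Implicit Types (u v w x y p : 'rV[R]_m) (A : set 'rV[R]_m).

Lemma dotC u v : dot u v = dot v u.
Proof. by apply: eq_bigr => i _; rewrite mulrC. Qed.

Lemma dotDl u v w : dot (u + v) w = dot u w + dot v w.
Proof. by rewrite /dot -big_split; apply: eq_bigr => i _; rewrite mxE mulrDl. Qed.

Lemma dotZl k u v : dot (k *: u) v = k * dot u v.
Proof. by rewrite /dot mulr_sumr; apply: eq_bigr => i _; rewrite mxE mulrA. Qed.

Lemma dotNl u v : dot (- u) v = - dot u v.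
Proof. by rewrite -scaleN1r dotZl mulN1r. Qed.

Lemma dotDr u v w : dot w (u + v) = dot w u + dot w v.
Proof. by rewrite dotC dotDl !(dotC w). Qed.

Lemma dotZr k u v : dot v (k *: u) = k * dot v u.
Proof. by rewrite dotC dotZl dotC. Qed.

Lemma dotBl u v w : dot (u - v) w = dot u w - dot v w.
Proof. by rewrite dotDl dotNl. Qed.

Lemma dotBr u v w : dot w (u - v) = dot w u - dot w v.
Proof. by rewrite !(dotC w) dotBl. Qed.

Lemma dot_ge0 u : 0 <= dot u u.
Proof. by apply: sumr_ge0 => i _; rewrite -expr2 sqr_ge0. Qed.

Lemma dot_eq0 u : (dot u u == 0) = (u == 0).
Proof.
apply/eqP/eqP => [u0|->]; last by rewrite /dot big1// => i _; rewrite mxE mul0r.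
have u0i i : u 0 i * u 0 i = 0.
  by apply: (psumr_eq0P _ u0) => // j _; rewrite -expr2 sqr_ge0.
by apply/rowP => i; rewrite mxE; apply/eqP; rewrite -sqrf_eq0 expr2 u0i.
Qed.

Lemma enorm_ge0 u : 0 <= enorm u.
Proof. exact: sqrtr_ge0. Qed.

Lemma sqr_enorm u : enorm u ^+ 2 = dot u u.
Proof. by rewrite sqr_sqrtr// dot_ge0. Qed.

Lemma enorm_eq0 u : (enorm u == 0) = (u == 0).
Proof. by rewrite -sqrf_eq0 sqr_enorm dot_eq0. Qed.

Lemma enorm_gt0 u : (0 < enorm u) = (u != 0).
Proof. by rewrite lt0r enorm_ge0 andbT enorm_eq0. Qed.

Lemma enorm0 : enorm (0 : 'rV[R]_m) = 0.
Proof. by apply/eqP; rewrite enorm_eq0. Qed.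

Lemma enormZ k u : enorm (k *: u) = `|k| * enorm u.
Proof.
by rewrite /enorm dotZl dotZr mulrA -expr2 sqrtrM ?sqr_ge0// sqrtr_sqr.
Qed.

Lemma enormN u : enorm (- u) = enorm u.
Proof. by rewrite -scaleN1r enormZ normrN1 mul1r. Qed.

Lemma edistC u v : enorm (u - v) = enorm (v - u).
Proof. by rewrite -enormN opprB. Qed.

(** The squared length of |v|^2 u - (u, v) v is |v|^2 times the defect in the
    squared inequality. *)
Lemma cauchy_schwarz u v : `|dot u v| <= enorm u * enorm v.
Proof.
rewrite -ler_sqr ?nnegrE ?mulr_ge0 ?enorm_ge0// real_normK ?num_real//.
rewrite exprMn !sqr_enorm.
have [->|v0] := eqVneq v 0.
  by rewrite -(scale0r (0 : 'rV[R]_m)) !dotZr !mul0r mulr0 expr0n.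
have vv : 0 < dot v v by rewrite lt0r dot_eq0 v0 dot_ge0.
have := dot_ge0 (dot v v *: u - dot u v *: v).
rewrite !(dotBl, dotBr, dotZl, dotZr) (dotC v u) => H.
rewrite -(ler_pM2l vv) -subr_ge0; apply: le_trans H _.
by rewrite le_eqVlt; apply/orP; left; apply/eqP; ring.
Qed.

Lemma ler_enormD u v : enorm (u + v) <= enorm u + enorm v.
Proof.
rewrite -ler_sqr ?nnegrE ?addr_ge0 ?enorm_ge0// sqrrD !sqr_enorm.
rewrite dotDl !dotDr (dotC v u).
have := le_trans (ler_norm _) (cauchy_schwarz u v); lra.
Qed.

Lemma ler_edistD x y w : enorm (x - w) <= enorm (x - y) + enorm (y - w).
Proof. by rewrite -{1}(subrK y x) -addrA ler_enormD. Qed.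

Lemma ler_enorm_sum (I : finType) (P : pred I) (f : I -> 'rV[R]_m) :
  enorm (\sum_(i | P i) f i) <= \sum_(i | P i) enorm (f i).
Proof.
elim/big_ind2 : _ => [|u a v b ua vb|//]; first by rewrite enorm0.
exact: le_trans (ler_enormD _ _) (lerD ua vb).
Qed.

(** With [enorm_le_norm], lets topological statements, which refer to the sup norm,
    be used with Euclidean balls. *)
Lemma norm_le_enorm u : `|u| <= enorm u.
Proof.
rewrite [leLHS]mx_normrE; apply/bigmax_leP; split => [|[i j] _ /=].
  exact: enorm_ge0.
rewrite ord1 -ler_sqr ?nnegrE ?enorm_ge0// real_normK ?num_real// sqr_enorm.
rewrite /dot (bigD1 j)//= expr2 lerDl.
by apply: sumr_ge0 => k _; rewrite -expr2 sqr_ge0.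
Qed.

Lemma enorm_le_norm u : enorm u <= m%:R * `|u|.
Proof.
rewrite {1}(row_sum_delta u); apply: le_trans (ler_enorm_sum _ _) _.
have -> : m%:R * `|u| = \sum_(i < m) `|u|.
  by rewrite sumr_const card_ord mulr_natl.
apply: ler_sum => i _; rewrite enormZ.
suff -> : enorm (delta_mx 0 i : 'rV[R]_m) = 1.
  rewrite mulr1 [leRHS]mx_normrE.
  by apply: (le_bigmax _ (fun ij => `|u ij.1 ij.2|) (0, i)).
rewrite /enorm /dot (bigD1 i)//= big1 => [|j ji]; rewrite !mxE ?eqxx.
  by rewrite mulr1 addr0 sqrtr1.
by rewrite (negbTE ji) mulr0.
Qed.

Lemma near_eball p (P : 'rV[R]_m -> Prop) :
  (\forall x \near p, P x) <->
  exists2 d, 0 < d & forall x, enorm (x - p) < d -> P x.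
Proof.
split=> [/nbhs_ballP[d /= d0 dP]|[d d0 dP]].
  exists d => // x xp; apply: dP; rewrite -ball_normE /= distrC.
  exact: le_lt_trans (norm_le_enorm _) xp.
apply/nbhs_ballP; exists (d / m.+1%:R); first by rewrite /= divr_gt0.
move=> x; rewrite -ball_normE /= distrC ltr_pdivlMr// mulrC => xp; apply: dP.
apply: le_lt_trans (enorm_le_norm _) (le_lt_trans _ xp).
by rewrite ler_wpM2r// ler_nat.
Qed.

Lemma edist_continuous x : continuous (fun y => enorm (x - y)).
Proof.
move=> y; apply/(@cvgrPdist_lt _ _ _ (nbhs y)) => e e0; apply/near_eball; exists e => // z zy.
apply: le_lt_trans zy; have := ler_edistD x y z; have := ler_edistD x z y.
by rewrite (edistC y z) ler_norml => *; apply/andP; split; lra.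
Qed.

Lemma dist_le x y A : A y -> dist x A <= enorm (x - y).
Proof.
move=> Ay; apply: ge_inf; last by exists y.
by exists 0 => _ [z _ <-]; exact: enorm_ge0.
Qed.

Lemma dist_lower x A c :
  A !=set0 -> (forall y, A y -> c <= enorm (x - y)) -> c <= dist x A.
Proof.
move=> [y Ay] cA; apply: lb_le_inf; first by exists (enorm (x - y)); exists y.
by move=> _ [z Az <-]; exact: cA.
Qed.

Lemma dist_ge0 x A : 0 <= dist x A.
Proof.
have [A0|] := pselect (A !=set0); first by apply: dist_lower => // *; exact: enorm_ge0.
by move=> A0; rewrite /dist inf_out// => -[[_ [y Ay _]] _]; apply: A0; exists y.
Qed.

Lemma compact_closestP A x : compact A -> A !=set0 -> closest A x (proj A x).
Proof.
move=> cA A0; suff [y Ay] : exists y, closest A x y by exact: getI Ay.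
have [|y yA ymin] := @compact_EVT_min _ _ (fun y => enorm (x - y)) A A0 cA.
  by apply: continuous_subspaceT; exact: edist_continuous.
exists y; split=> [|z Az]; first exact: set_mem.
by apply: ymin; rewrite inE.
Qed.

Lemma closest_dist A x y : closest A x y -> enorm (x - y) = dist x A.
Proof.
move=> [Ay ymin]; apply/eqP; rewrite eq_le dist_le// andbT.
by apply: dist_lower => //; exists y.
Qed.

End EuclideanSpace.

(** * Strict differentiability of smooth functions *)

Section StrictDifferentiability.
Context {R : realType} {m : nat}.
Implicit Types (F : 'rV[R]_m -> R) (x y w p : 'rV[R]_m).

Lemma smooth_differentiable F x : smooth F -> differentiable F x.
Proof. by move/(_ [::] x). Qed.

Lemma derive_grad F x w : differentiable F x -> 'D_w F x = dot (grad F x) w.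
Proof.
move=> dF; rewrite deriveE// {1}(row_sum_delta w) linear_sum.
by apply: eq_bigr => i _; rewrite linearZ /= mxE deriveE// mulrC.
Qed.

(** The difference quotients of F along the line are those that define the
    directional derivative of F, so no chain rule is involved. *)
Lemma is_derive_line F y w (t : R) : differentiable F (y + t *: w) ->
  is_derive t 1 (fun t => F (y + t *: w)) (dot (grad F (y + t *: w)) w).
Proof.
move=> dF; have D : derivable F (y + t *: w) w by exact: diff_derivable.
rewrite -(derive_grad w dF).
have E : (fun h : R => h^-1 *: (((fun t => F (y + t *: w)) \o shift t) (h *: 1)
             - F (y + t *: w))) =
         (fun h => h^-1 *: ((F \o shift (y + t *: w)) (h *: w) - F (y + t *: w))).
  apply/funext => h /=; congr (_ *: (F _ - _)).
  by rewrite [h *: 1]mulr1 scalerDl addrCA.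
by split; rewrite /derivable/derive E.
Qed.

Lemma line_continuous F y w :
  (forall x, differentiable F x) -> continuous (fun t : R => F (y + t *: w)).
Proof.
move=> dF t; apply: differentiable_continuous; apply/derivable1_diffP.
by have [] := is_derive_line (dF (y + t *: w)).
Qed.

Lemma MVT_line F y w : (forall x, differentiable F x) ->
  exists2 t : R, 0 <= t <= 1 & F (y + w) - F y = dot (grad F (y + t *: w)) w.
Proof.
move=> dF.
have [|||t] := @MVT_segment R (fun t => F (y + t *: w))
    (fun t => dot (grad F (y + t *: w)) w) 0 1.
- by [].
- by move=> t _; apply: is_derive_line.
- by apply: continuous_subspaceT; exact: line_continuous.
rewrite in_itv /= scale1r scale0r addr0 subr0 mulr1 => t01 ->.
by exists t.
Qed.

Lemma grad_continuous F p (e : R) : smooth F -> 0 < e ->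
  \forall x \near p, enorm (grad F x - grad F p) <= e.
Proof.
move=> sF e0; have e1 : 0 < e / m.+1%:R by rewrite divr_gt0.
have H : \forall x \near p, forall i : 'I_m,
    `|'D_(delta_mx 0 i) F p - 'D_(delta_mx 0 i) F x| < e / m.+1%:R.
  apply: (filter_forall (F := nbhs p)) => i.
  have := differentiable_continuous (sF [:: i] p).
  by move/(@cvgrPdist_lt _ _ _ (nbhs p)); apply.
apply: filterS H => x H.
apply: le_trans (enorm_le_norm _) _.
have : `|grad F x - grad F p| <= e / m.+1%:R.
  rewrite [leLHS]mx_normrE; apply/bigmax_leP; split => [|[i j] _ /=].
    exact: ltW.
  by rewrite !mxE distrC ltW.
rewrite ler_pdivlMr// mulrC; apply: le_trans.
by rewrite ler_wpM2r// ler_nat.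
Qed.

(** The mean value theorem writes F x - F y with the gradient at a point of the
    segment [x, y], which stays in the ball by convexity, and there the gradient is
    within e of its value at p. *)
Lemma smooth_strict_diff F p (e : R) : smooth F -> 0 < e ->
  exists2 d : R, 0 < d &
  forall x y, enorm (x - p) < d -> enorm (y - p) < d ->
  `|F x - F y - dot (grad F p) (x - y)| <= e * enorm (x - y).
Proof.
move=> sF e0; have /near_eball[d d0 dP] := grad_continuous p sF e0.
exists d => // x y xp yp.
have [|t /andP[t0 t1]] := @MVT_line F y (x - y).
  by move=> z; exact: smooth_differentiable.
rewrite [y + (x - y)]addrC subrK => ->; rewrite -dotBl.
apply: le_trans (cauchy_schwarz _ _) _; rewrite ler_wpM2r ?enorm_ge0//.
apply: dP.
have -> : y + t *: (x - y) - p = (1 - t) *: (y - p) + t *: (x - p).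
  by apply/rowP => i; rewrite !mxE; ring.
apply: le_lt_trans (ler_enormD _ _) _; rewrite !enormZ.
rewrite (ger0_norm t0) ger0_norm ?subr_ge0//.
(* The strict inequality comes from the end point with the larger weight. *)
have [tlt|] := ltP (2^-1) t.
  have : t * enorm (x - p) < t * d by rewrite ltr_pM2l//; lra.
  have : (1 - t) * enorm (y - p) <= (1 - t) * d.
    by rewrite ler_wpM2l ?subr_ge0// ltW.
  by lra.
move=> tle.
have : t * enorm (x - p) <= t * d by rewrite ler_wpM2l// ltW.
have : (1 - t) * enorm (y - p) < (1 - t) * d by rewrite ltr_pM2l//; lra.
by lra.
Qed.

End StrictDifferentiability.

(** * First-order behaviour of the signed distance *)

Section SignedDistance.
Context {R : realType} {m : nat}.
Variable F : 'rV[R]_m -> R.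
Hypothesis sF : smooth F.
Local Notation Gamma := (level_set F).
Implicit Types (x y w p q : 'rV[R]_m).

(** F vanishes on Gamma and is Lipschitz with constant |grad F p| + e near p. Points
    of Gamma outside this neighbourhood are farther from x than p itself. *)
Lemma level_dist_lower p (e : R) : Gamma p -> 0 < e ->
  exists2 d : R, 0 < d & forall x, enorm (x - p) < d ->
  `|F x| <= (enorm (grad F p) + e) * dist x Gamma.
Proof.
move=> Gp e0; have [d d0 dP] := smooth_strict_diff p sF e0.
have lip x y : enorm (x - p) < d -> enorm (y - p) < d -> Gamma y ->
    `|F x| <= (enorm (grad F p) + e) * enorm (x - y).
  move=> xp yp Gy; have := dP _ _ xp yp; rewrite [F y]Gy subr0.
  have := cauchy_schwarz (grad F p) (x - y).
  have := lerB_dist (F x) (dot (grad F p) (x - y)); rewrite mulrDl; lra.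
exists (d / 2); first by rewrite divr_gt0.
have ge0 : 0 < enorm (grad F p) + e by have := enorm_ge0 (grad F p); lra.
move=> x xp; rewrite -ler_pdivrMl//; apply: dist_lower; first by exists p.
move=> y Gy; rewrite ler_pdivrMl//.
have [xy|xy] := ltP (enorm (x - y)) (d / 2).
  apply: lip => //; first lra.
  by have := ler_edistD y x p; rewrite (edistC y x); lra.
apply: le_trans (lip x p _ _ Gp) _; [lra|by rewrite subrr enorm0|].
by rewrite ler_wpM2l ?ltW//; lra.
Qed.

(** Moving from x along -sign(F x) grad F p decreases |F| at rate at least
    |grad F p| - e, so the intermediate value theorem yields a point of Gamma at
    distance at most |F x| / (|grad F p| - e), provided the walk stays where strict
    differentiability holds. *)
Lemma level_dist_upper p (e : R) :
  Gamma p -> 0 < e -> e < enorm (grad F p) ->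
  exists2 d : R, 0 < d & forall x, enorm (x - p) < d ->
  (enorm (grad F p) - e) * dist x Gamma <= `|F x|.
Proof.
set G := enorm (grad F p) => Gp e0 eG; have G0 := lt_trans e0 eG.
have [d d0 dP] := smooth_strict_diff p sF e0.
have Ge0 : 0 < G - e by lra.
(* The walk ends within |x - p| + (G + e) / (G - e) |x - p|, that is
   2 G / (G - e) |x - p|, of p; the radius makes this less than d. *)
exists (d * (G - e) / (2 * G)); first by rewrite divr_gt0 ?mulr_gt0.
move=> x; rewrite ltr_pdivlMr ?mulr_gt0// => xp.
have [Fx0|Fx0] := eqVneq (F x) 0.
  have := @dist_le _ _ x x Gamma Fx0; rewrite subrr enorm0 Fx0 normr0 => D0.
  by rewrite mulr_ge0_le0 ?(ltW Ge0).
have xp0 := enorm_ge0 (x - p).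
have xpd : enorm (x - p) < d.
  rewrite -(ltr_pM2r Ge0); apply: le_lt_trans xp.
  by rewrite ler_wpM2l//; lra.
have pd : enorm (p - p) < d by rewrite subrr enorm0.
have Fx : `|F x| <= (G + e) * enorm (x - p).
  have := dP _ _ xpd pd; rewrite [F p]Gp subr0.
  have := cauchy_schwarz (grad F p) (x - p).
  have := lerB_dist (F x) (dot (grad F p) (x - p)); rewrite mulrDl -/G; lra.
set v := - ((Num.sg (F x) / G) *: grad F p).
have sg1 : `|Num.sg (F x)| = 1 by rewrite normr_sg Fx0.
have v1 : enorm v = 1.
  by rewrite enormN enormZ normrM normfV sg1 mul1r -/G (gtr0_norm G0) mulVf ?gt_eqF.
set tau := `|F x| / (G - e).
have tau0 : 0 <= tau by rewrite divr_ge0// ltW.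
have taud : enorm (x + tau *: v - p) < d.
  rewrite addrAC; apply: le_lt_trans (ler_enormD _ _) _.
  rewrite enormZ v1 mulr1 ger0_norm// -(ltr_pM2r Ge0) mulrDl divfK ?gt_eqF//.
  apply: le_lt_trans xp; rewrite -[leRHS]/(enorm (x - p) * (2 * G)).
  by have := Fx; nra.
have Ftau : Num.sg (F x) * F (x + tau *: v) <= 0.
  have := dP _ _ taud xpd; rewrite [x + _]addrC addrK enormZ v1 mulr1 (ger0_norm tau0).
  have -> : dot (grad F p) (tau *: v) = - (Num.sg (F x) * (tau * G)).
    rewrite /v -scaleNr !dotZr -sqr_enorm -/G; field; exact: lt0r_neq0.
  rewrite opprK [tau *: v + x]addrC -[X in X <= _]mul1r -sg1 -normrM !mulrDr mulrN.
  rewrite -normrEsg mulrA -expr2 sqr_sg Fx0 mul1r => /(le_trans (ler_norm _)).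
  have : tau * (G - e) = `|F x| by rewrite divfK// gt_eqF.
  by lra.
have [||c] := @IVT R (fun t => Num.sg (F x) * F (x + t *: v)) 0 tau 0 tau0.
- apply: continuous_subspaceT => t; apply: cvgM; first exact: cvg_cst.
  by apply: line_continuous => z; exact: smooth_differentiable.
- rewrite scale0r addr0 -normrEsg ge_min le_max Ftau normr_ge0 orbT.
  by [].
rewrite in_itv /= => /andP[c0 ctau] /eqP; rewrite mulf_eq0 sgr_eq0 (negbTE Fx0) /=.
move=> /eqP Gz; have := @dist_le _ _ x _ Gamma Gz.
rewrite opprD addNKr enormN enormZ v1 mulr1 (ger0_norm c0) => dc.
rewrite mulrC -ler_pdivlMr//; exact: le_trans dc ctau.
Qed.

(** Both distance bounds say that |G dist(x, Gamma) - |F x|| <= e dist(x, Gamma), and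
    multiplying by the sign of F x turns this into a comparison of the signed
    quantities. *)
Lemma sdist_first_order p (e : R) : Gamma p -> 0 < enorm (grad F p) -> 0 < e ->
  exists2 d : R, 0 < d & forall x, enorm (x - p) < d ->
  `|enorm (grad F p) * sdist F x - F x| <= e * enorm (x - p).
Proof.
set G := enorm _ => Gp G0 e0.
pose e' := Num.min e (G / 2).
have e'0 : 0 < e' by rewrite lt_min e0 divr_gt0.
have e'e : e' <= e by rewrite ge_min lexx.
have e'G : e' < G by rewrite gt_min; apply/orP; right; lra.
have [d1 d10 d1P] := level_dist_lower Gp e'0.
have [d2 d20 d2P] := level_dist_upper Gp e'0 e'G.
exists (Num.min d1 d2) => [|x]; first by rewrite lt_min d10.
rewrite lt_min => /andP[/d1P lo /d2P up].
have D0 := dist_ge0 x Gamma.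
have -> : G * sdist F x - F x = Num.sg (F x) * (G * dist x Gamma - `|F x|).
  by rewrite mulrBr -numEsg /sdist mulrCA.
have : `|G * dist x Gamma - `|F x| | <= e' * dist x Gamma.
  by rewrite ler_norml; move: lo up; rewrite -/G !mulrDl mulNr => lo up; apply/andP; split; lra.
have Dp := dist_le x Gp.
rewrite normrM normr_sg => H; apply: (@le_trans _ _ (e' * dist x Gamma)).
  by case: (_ != _); rewrite ?mul1r// mul0r mulr_ge0// ltW.
by apply: ler_pM => //; exact: ltW.
Qed.

(** By [sdist_first_order] the difference quotients of G sdist - F at p tend to 0,
    so the directional derivatives of sdist exist and are those of F divided by G. *)
Lemma normal_level p : Gamma p -> grad F p != 0 ->
  normal F p = (enorm (grad F p))^-1 *: grad F p.
Proof.
rewrite -enorm_gt0; set G := enorm _ => Gp G0.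
have sp : sdist F p = 0 by rewrite /sdist [F p]Gp sgr0 mul0r.
apply/rowP => i; rewrite !mxE; set v := delta_mx 0 i; apply: cvg_lim => //.
have Fv : (h^-1 *: ((F \o shift p) (h *: v) - F p) @[h --> 0^']) --> 'D_v F p.
  have : derivable F p v by apply: diff_derivable; exact: smooth_differentiable.
  exact.
pose r (h : R) := h^-1 * (G * sdist F (h *: v + p) - F (h *: v + p)).
have r0 : r h @[h --> 0^'] --> 0.
  apply/cvgrPdist_le => e e0.
  have v1 : 0 < enorm v + 1 by have := enorm_ge0 v; lra.
  have [|d d0 dP] := @sdist_first_order p (e / (enorm v + 1)) Gp G0.
    by rewrite divr_gt0.
  have : \forall h \near (0 : R)^', `|h| < d / (enorm v + 1).
    by apply: dnbhs0_lt; rewrite divr_gt0.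
  apply: filterS => h; rewrite ltr_pdivlMr// => hd.
  rewrite sub0r normrN normrM normfV.
  have [->|h0] := eqVneq h 0; first by rewrite normr0 invr0 mul0r ltW.
  have h1 : 0 < `|h| by rewrite normr_gt0.
  rewrite ler_pdivrMl//; apply: le_trans (dP _ _) _.
    rewrite addrK enormZ; apply: le_lt_trans hd.
    by rewrite ler_wpM2l//; lra.
  rewrite addrK enormZ mulrCA ler_wpM2l// mulrAC ler_pdivrMr//.
  by rewrite ler_wpM2l ?ltW//; lra.
have -> : (fun h => h^-1 *: ((sdist F \o shift p) (h *: v) - sdist F p)) =
          (fun h => G^-1 * (r h + h^-1 *: ((F \o shift p) (h *: v) - F p))).
  apply/funext => h; rewrite /r /= sp [F p]Gp /GRing.scale /= !subr0.
  by rewrite -mulrDr subrK [RHS]mulrCA mulKf ?gt_eqF.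
rewrite -['D_v F p]add0r; apply: cvgM; first exact: cvg_cst.
exact: cvgD r0 Fv.
Qed.

End SignedDistance.

(** * Distance of normal offsets to the level set *)

Section NormalOffset.
Context {R : realType} {m : nat}.
Variable F : 'rV[R]_m -> R.
Hypotheses (sF : smooth F) (rF : regular F).
Local Notation Gamma := (level_set F).
Implicit Types (x y w p q : 'rV[R]_m).

Lemma dot_grad_normal q : Gamma q -> dot (grad F q) (normal F q) = enorm (grad F q).
Proof.
move=> Gq; rewrite normal_level ?rF// dotZr -sqr_enorm expr2 mulKf//.
by rewrite enorm_eq0 rF.
Qed.

Lemma enorm_normal q : Gamma q -> enorm (normal F q) = 1.
Proof.
move=> Gq; rewrite normal_level ?rF// enormZ normfV ger0_norm ?enorm_ge0//.
by rewrite mulVf// enorm_eq0 rF.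
Qed.

(** With e = |grad F p| / 8, one has |F (q + t n(q))| >= (1 - 3/8) |grad F p| |t|, the
    losses coming from strict differentiability and twice from the variation of the
    gradient between p and q, while F has Lipschitz constant (1 + 1/8) |grad F p|;
    the quotient 5/9 exceeds 1/2. *)
Lemma offset_dist_local p : Gamma p ->
  exists2 d : R, 0 < d & forall q (t : R), enorm (q - p) < d -> Gamma q ->
  `|t| < d -> `|t| / 2 <= dist (q + t *: normal F q) Gamma.
Proof.
move=> Gp; have := rF Gp; rewrite -enorm_gt0.
set G := enorm (grad F p) => G0; have e0 : 0 < G / 8 by lra.
have [d1 d10 d1P] := level_dist_lower sF Gp e0.
have [d2 d20 d2P] := smooth_strict_diff p sF e0.
have /near_eball[d3 d30 d3P] := grad_continuous p sF e0.
exists (Num.min d1 (Num.min d2 d3) / 2).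
  by rewrite divr_gt0// !lt_min d10 d20.
move=> q t; rewrite !ltr_pdivlMr// !lt_min.
move=> /and3P[q1 q2 q3] Gq /and3P[t1 t2 t3].
set n := normal F q; have n1 : enorm n = 1 by exact: enorm_normal.
have qp0 := enorm_ge0 (q - p); have tn0 := normr_ge0 t.
have xp : enorm (q + t *: n - p) <= enorm (q - p) + `|t|.
  rewrite addrAC; apply: le_trans (ler_enormD _ _) _.
  by rewrite enormZ n1 mulr1.
have up : `|F (q + t *: n)| <= (G + G / 8) * dist (q + t *: n) Gamma.
  by apply: d1P; lra.
have := d2P (q + t *: n) q; rewrite [F q]Gq subr0 [q + _]addrC addrK.
rewrite enormZ n1 mulr1 dotZr [_ + q]addrC => lo.
have {}lo : `|F (q + t *: n) - t * dot (grad F p) n| <= G / 8 * `|t|.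
  by apply: lo; lra.
have gq : enorm (grad F q - grad F p) <= G / 8 by apply: d3P; lra.
have gG : G <= enorm (grad F q) + G / 8.
  have := ler_edistD (grad F p) (grad F q) 0.
  by rewrite !subr0 -/G (edistC (grad F p)); lra.
have pn : G - 2 * (G / 8) <= dot (grad F p) n.
  have := cauchy_schwarz (grad F q - grad F p) n.
  rewrite dotBl dot_grad_normal// n1 mulr1.
  by move=> /(le_trans (ler_norm _)); lra.
have : `|t| * (G - 2 * (G / 8)) <= `|t * dot (grad F p) n|.
  by rewrite normrM ler_wpM2l// (le_trans pn)// ler_norm.
have := lerB_dist (t * dot (grad F p) n) (F (q + t *: n)).
rewrite distrC => tri low.
have {}low : `|t| * (5 / 8 * G) <= (G + G / 8) * dist (q + t *: n) Gamma by lra.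
have : G * (`|t| / 2) <= G * dist (q + t *: n) Gamma.
  have := mulr_ge0 tn0 (ltW G0); lra.
by rewrite ler_pM2l.
Qed.

(** The admissible range of t is locally bounded below along Gamma, hence bounded
    below by compactness. *)
Lemma offset_dist : compact Gamma ->
  exists2 c : R, 0 < c & forall q (t : R), Gamma q -> `|t| < c ->
  `|t| / 2 <= dist (q + t *: normal F q) Gamma.
Proof.
move=> /compact_near_coveringP cG.
pose P (c : R) q := forall t, Gamma q -> `|t| < c ->
  `|t| / 2 <= dist (q + t *: normal F q) Gamma.
have cP : \forall c \near (0 : R)^'+, Gamma `<=` P c.
  apply: cG => p Gp; have [d d0 dP] := offset_dist_local Gp.
  exists ([set x | enorm (x - p) < d], [set c | c < d]).
    by split; [apply/near_eball; exists d | exact: nbhs_right_lt].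
  move=> [q c] [/= qp cd] t Gq tc; apply: dP => //; exact: lt_trans tc cd.
have [c [c0 {}cP]] := filter_ex (filterI (nbhs_right_gt (0 : R)) cP).
by exists c => // q t Gq; apply: cP.
Qed.

End NormalOffset.

(** * Perturbation of simplices *)

Section Perturbation.
Context {R : realType} {m : nat} {V : finType}.
Implicit Types (x : V -> 'rV[R]_m) (t : {set V}).

Lemma hull_shift x x' t (w : V -> R) (e : R) :
  (forall v, 0 <= w v) -> \sum_(v in t) w v = 1 ->
  (forall v, v \in t -> enorm (x' v - x v) <= e) ->
  enorm (\sum_(v in t) w v *: x' v - \sum_(v in t) w v *: x v) <= e.
Proof.
move=> w0 w1 xe; rewrite -sumrB; apply: le_trans (ler_enorm_sum _ _) _.
rewrite -[e]mul1r -w1 mulr_suml; apply: ler_sum => v vt.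
by rewrite -scalerBr enormZ ger0_norm// ler_wpM2l// xe.
Qed.

Lemma ediam_ge0 (A : set 'rV[R]_m) : 0 <= ediam A.
Proof.
rewrite /ediam; set S := (X in sup X).
have [[[z Sz] ubS]|/sup_out ->//] := pselect (has_sup S).
apply: le_trans (ub_le_sup ubS Sz); case: Sz => p _ <-; exact: enorm_ge0.
Qed.

(** A positive value of the diameter already certifies that the supremum is that of
    a bounded set, because the supremum of an unbounded set is 0 by convention. *)
Lemma ediam_ub (A : set 'rV[R]_m) y z : 0 < ediam A -> A y -> A z ->
  enorm (y - z) <= ediam A.
Proof.
move=> dA Ay Az; apply: ub_le_sup; last by exists (y, z).
have [[]//|/sup_out A0] := pselect (has_sup [set enorm (p.1 - p.2) | p in A `*` A]).
by rewrite /ediam A0 ltxx in dA.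
Qed.

(** Points with the same barycentric weights are at distance at most e. *)
Lemma diamT_perturb x x' t (e : R) : 0 < diamT x t -> hull x' t !=set0 ->
  (forall v, v \in t -> enorm (x' v - x v) <= e) ->
  diamT x' t <= diamT x t + 2 * e.
Proof.
move=> d0 [y0 hy0] xe; apply: ge_sup.
  by exists (enorm (y0 - y0)); exists (y0, y0).
move=> _ [[y z] [/= [w [w0 w1 ->]] [w' [w'0 w'1 ->]]] <-].
have := hull_shift w0 w1 xe; have := hull_shift w'0 w'1 xe.
have : enorm (\sum_(v in t) w v *: x v - \sum_(v in t) w' v *: x v) <= diamT x t.
  by apply: ediam_ub => //; [exists w|exists w'].
set a := \sum_(v in t) w v *: x' v; set b := \sum_(v in t) w v *: x v.
set a' := \sum_(v in t) w' v *: x' v; set b' := \sum_(v in t) w' v *: x v.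
move=> bb' a'b' ab; have := ler_edistD a b a'; have := ler_edistD b b' a'.
by rewrite (edistC b' a'); lra.
Qed.

(** As s >= 0, the hypothesis rules out the default value 0 of the supremum, so it is
    approached by actual balls. *)
Lemma inscribed_ball (A : set 'rV[R]_m) (s : R) : 0 <= s -> s < inball_diam A ->
  exists c r, s < 2 * r /\ [set y | enorm (y - c) <= r] `<=` A.
Proof.
rewrite /inball_diam; set S := (X in sup X) => s0 sS.
have [[S0 _]|/sup_out S0] := pselect (has_sup S); last first.
  by move: sS; rewrite S0 => /(le_lt_trans s0); rewrite ltxx.
by have [_ [r [r0 [c cA]] <-] sr] := sup_gt S0 sS; exists c, r.
Qed.

(** Let u be the combination of the vertices with weights w. The points c and
    c + (r / |u|) u of the ball both lie in the simplex, and by affine independence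
    their barycentric coordinates differ by (r / |u|) w_v; both are in [0, 1]. *)
Lemma bary_weight_bound x t (w : V -> R) c (r : R) : is_simplex x t -> 0 < r ->
  [set y | enorm (y - c) <= r] `<=` hull x t -> \sum_(v in t) w v = 0 ->
  forall v, v \in t -> `|w v| * r <= enorm (\sum_(v in t) w v *: x v).
Proof.
move=> [_ ind] r0 cH w0 v vt; set u := \sum_(v in t) w v *: x v.
have [u0|] := eqVneq u 0.
  by rewrite (ind w w0 u0 v vt) normr0 mul0r enorm_ge0.
rewrite -enorm_gt0 => u0; set k := r / enorm u.
have k0 : 0 < k by rewrite divr_gt0.
have /cH[mu [mu0 mu1 cE]] : enorm (c - c) <= r by rewrite subrr enorm0 ltW.
have /cH[nu [nu0 nu1 uE]] : enorm (c + k *: u - c) <= r.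
  by rewrite [c + _]addrC addrK enormZ gtr0_norm// divfK ?gt_eqF.
have le1 (f : V -> R) : (forall v, 0 <= f v) -> \sum_(v in t) f v = 1 -> f v <= 1.
  by move=> f0 <-; rewrite (bigD1 v)//= lerDl sumr_ge0.
have : nu v - mu v - k * w v = 0.
  apply: (ind (fun v => nu v - mu v - k * w v)) => //.
    by rewrite !sumrB -mulr_sumr w0 mu1 nu1 subrr mulr0 subr0.
  under eq_bigr do rewrite !scalerBl -scalerA.
  by rewrite !sumrB -scaler_sumr -uE -cE [c + _]addrC addrK subrr.
have := le1 _ mu0 mu1; have := le1 _ nu0 nu1; have := mu0 v; have := nu0 v.
move=> nu0v mu0v nu1v mu1v kw.
have : k * `|w v| <= 1.
  by rewrite -[k]gtr0_norm// -normrM ler_norml; apply/andP; split; lra.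
by rewrite /k mulrAC ler_pdivrMr// mul1r mulrC.
Qed.

(** If the perturbed vertices satisfy a relation with weights w, the combination u of
    the original ones has |u| <= e \sum |w_v| <= (m + 1) e |u| / r by
    [bary_weight_bound]; since (m + 1) e < r, u = 0 and the original independence
    applies. *)
Lemma is_simplex_perturb x x' t c (r e : R) : is_simplex x t ->
  [set y | enorm (y - c) <= r] `<=` hull x t ->
  (forall v, v \in t -> enorm (x' v - x v) <= e) -> 0 <= e -> m.+1%:R * e < r ->
  is_simplex x' t.
Proof.
move=> simp cH xe e0 er; have [ct ind] := simp; split => // w w0 wx' v vt.
have r0 : 0 < r by apply: le_lt_trans er; rewrite mulr_ge0.
have B := bary_weight_bound simp r0 cH w0.
set u := \sum_(v in t) w v *: x v in B.
have ru : enorm u * r <= m.+1%:R * e * enorm u.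
  have uE : u = \sum_(v in t) w v *: (x v - x' v).
    by under eq_bigr do rewrite scalerBr; rewrite sumrB wx' subr0.
  apply: (@le_trans _ _ (\sum_(v in t) `|w v| * e * r)).
    rewrite -mulr_suml ler_pM2r// {1}uE.
    apply: le_trans (ler_enorm_sum _ _) _; apply: ler_sum => i it.
    by rewrite enormZ edistC ler_wpM2l// xe.
  apply: (@le_trans _ _ (\sum_(v in t) e * enorm u)).
    by apply: ler_sum => i it; rewrite mulrAC mulrC ler_wpM2l// B.
  by rewrite sumr_const ct -mulrA mulr_natl.
have u0 : u = 0.
  apply/eqP; apply: contraTT ru; rewrite -enorm_gt0 -ltNge => u0.
  by rewrite mulrC ltr_pM2l.
exact: ind w0 u0 v vt.
Qed.

End Perturbation.

(** * Displaced vertices and consistency *)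

Section VertexDisplacement.
Context {R : realType} {m : nat}.
Variable F : 'rV[R]_m -> R.
Hypotheses (sF : smooth F) (rF : regular F).
Hypotheses (cF : compact (level_set F)) (nF : level_set F !=set0).
Implicit Types (a x : 'rV[R]_m).

Lemma norm_sdist a : `|sdist F a| = dist a (level_set F).
Proof.
rewrite normrM normr_sg (ger0_norm (dist_ge0 _ _)).
have [Fa|_] := eqVneq (F a) 0; last by rewrite mul1r.
apply/eqP; rewrite mul0r eq_le dist_ge0/=.
by rewrite -(@enorm0 R m) -(subrr a) dist_le.
Qed.

Lemma norm_dsign s a : `|dsign F s a| = 1.
Proof.
by rewrite /dsign; case: ifPn => a0; rewrite ?normr_sign// normr_sg a0.
Qed.

(** A displaced vertex goes to its closest point, at distance less than rho h, and
    from there by rho h along a unit vector. *)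
Lemma displace_near rho h s a : 0 <= rho * h ->
  enorm (displace F rho h s a - a) <= 2 * (rho * h).
Proof.
move=> rh0; rewrite /displace; case: ifPn => [_|].
  by rewrite subrr enorm0 mulr_ge0.
rewrite -ltNge norm_sdist => da; have pa := compact_closestP a cF nF.
set p := proj _ _ in pa *; rewrite addrAC.
apply: le_trans (ler_enormD _ _) _.
rewrite enormZ enorm_normal//; last by case: pa.
rewrite mulr1 normrM norm_dsign mul1r (ger0_norm rh0) edistC (closest_dist pa); lra.
Qed.

(** An unmoved vertex is at distance at least rho h by the definition of the
    displacement, and a moved one is a normal offset of length rho h. *)
Lemma displace_far rho h s a (c : R) : 0 <= rho * h -> rho * h < c ->
  (forall q (t : R), level_set F q -> `|t| < c ->
     `|t| / 2 <= dist (q + t *: normal F q) (level_set F)) ->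
  rho * h / 2 <= dist (displace F rho h s a) (level_set F).
Proof.
move=> rh0 rhc cP; rewrite /displace; case: ifPn => [|_].
  by rewrite norm_sdist; lra.
have [Gp _] := compact_closestP a cF nF.
have nt : `|dsign F s a * (rho * h)| = rho * h.
  by rewrite normrM norm_dsign mul1r ger0_norm.
by have := cP _ (dsign F s a * (rho * h)) Gp; rewrite nt; apply.
Qed.

End VertexDisplacement.

Theorem proposition2p2 (R : realType) (m : nat) (hm : m = 3%N \/ m = 2%N)
    (sigma cm Cm : R) (hsigma : 0 < sigma) (hcm : 0 < cm) (hCm : 0 < Cm) :
  exists2 rho_star : R, 0 < rho_star &
  forall rho : R, 0 < rho -> rho <= rho_star ->
  forall F : 'rV[R]_m -> R,
    smooth F -> regular F -> compact (level_set F) ->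
    (0 < reach (level_set F))%E ->
  forall lo up : 'rV[R]_m, (forall i, lo 0 i < up 0 i) ->
  exists2 c0 : R, 0 < c0 &
  exists2 h0 : R, 0 < h0 &
  forall h : R, 0 < h -> h < h0 ->
  forall (V : finType) (x : V -> 'rV[R]_m) (T : {set {set V}}),
    initial_mesh lo up sigma cm Cm h x T ->
  forall s : V -> bool,
  forall t : {set V}, t \in T ->
    cut F (adjusted F rho h s x) t ->
    consistent F c0 (adjusted F rho h s x) t.
Proof.
have M0 : 0 < m.+1%:R :> R by [].
(* Each simplex contains a ball of radius r > cm h / (4 sigma), and vertices move by
   at most 2 rho h; this bound on rho gives (m + 1) (2 rho h) < r. *)
exists (cm / (8 * sigma * m.+1%:R)); first by rewrite divr_gt0 ?mulr_gt0.
move=> rho rho0 rho_le F sF rF cF reach0 lo up _.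
have [c c_gt0 cP] := offset_dist sF rF cF.
have [r0 r00 r0_le] : exists2 r0 : R, 0 < r0 & (r0%:E <= reach (level_set F))%E.
  case: (reach _) reach0 => [r||//]; last by exists 1 => //; rewrite leey.
  by rewrite lte_fin => r_gt0; exists r.
pose D := Cm + 4 * rho; have D0 : 0 < D by rewrite addr_gt0 ?mulr_gt0.
(* The added 1 makes K positive, so that it may be inverted below. *)
pose K := `|Kmax F| + 1; have K0 : 0 < K by rewrite ltr_wpDl.
have KF : `|Kmax F| <= K by rewrite lerDl.
exists (rho / (4 * D)); first by rewrite divr_gt0 ?mulr_gt0.
(* The four bounds make, in this order: the normal offsets of length rho h those of
   [offset_dist]; the diameter less than the reach; the diameter times the curvature
   less than 1/4; and the curvature times the squared diameter less than rho h / 2. *)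
exists (Num.min (c / rho) (Num.min (r0 / D)
          (Num.min (4 * D * K)^-1 (rho / (2 * D ^+ 2 * K))))).
  by rewrite !lt_min invr_gt0 !divr_gt0 ?mulr_gt0 ?exprn_gt0.
move=> h h_gt0; rewrite !lt_min => /and4P[hc hr hK1 hK2].
move=> V x T mesh s t tT cut_t.
have nF : level_set F !=set0 by have [y []] := cut_t; exists y.
have nH : hull (adjusted F rho h s x) t !=set0 by have [y []] := cut_t; exists y.
have rh0 : 0 < rho * h by rewrite mulr_gt0.
have near_x v : v \in t -> enorm (adjusted F rho h s x v - x v) <= 2 * (rho * h).
  by move=> _; apply: displace_near => //; exact: ltW.
have /andP[dlo dup] := mesh_quasi_uniform mesh tT.
have d0 : 0 < diamT x t by apply: lt_le_trans dlo; rewrite mulr_gt0.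
have diam_le : diamT (adjusted F rho h s x) t <= D * h.
  have := diamT_perturb d0 nH near_x; rewrite /D; lra.
have diam0 := ediam_ge0 (hull (adjusted F rho h s x) t).
rewrite -/(diamT _ _) in diam0.
have DhK : D * h * K < 4^-1.
  by move: hK1; rewrite -[_^-1]mul1r ltr_pdivlMr ?mulr_gt0//; lra.
have DDhK : K * (D * h) ^+ 2 < rho * h / 2.
  move: hK2; rewrite ltr_pdivlMr ?mulr_gt0 ?exprn_gt0// -(ltr_pM2r h_gt0); lra.
split.
- have inb : cm * h / (2 * sigma) < inball_diam (hull x t).
    have := mesh_shape_regular mesh tT; rewrite ltr_pdivrMr ?mulr_gt0//.
    by have := mulr_gt0 hcm h_gt0; lra.
  have [|q [r [sr qH]]] := inscribed_ball _ inb.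
    by rewrite divr_ge0 ?mulr_ge0// ltW.
  apply: (is_simplex_perturb (mesh_simplex mesh tT) qH near_x).
    by rewrite mulr_ge0// ltW.
  move: sr; rewrite ltr_pdivrMr ?mulr_gt0// => sr.
  move: rho_le; rewrite ler_pdivlMr ?mulr_gt0// -(ler_pM2r h_gt0) => rho_le.
  by rewrite -(ltr_pM2r hsigma); lra.
- apply: lt_le_trans r0_le; rewrite lte_fin; apply: le_lt_trans diam_le _.
  by rewrite mulrC -ltr_pdivlMr.
- apply: le_trans (ltW DhK); apply: le_trans (ler_norm _) _.
  by rewrite normrM (ger0_norm diam0) ler_pM.
- move=> v vt; have : rho * h / 2 <= dist (adjusted F rho h s x v) (level_set F).
    by apply: (displace_far cF nF _ _ _ _ cP) => //; rewrite ?ltW// mulrC -ltr_pdivlMr.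
  apply: lt_le_trans; rewrite gt_max; apply/andP; split.
    apply: (@le_lt_trans _ _ (rho * h / 4)); last by lra.
    rewrite mulrAC ler_pdivrMr ?mulr_gt0//.
    have := diam_le; rewrite -(ler_pM2l rho0); lra.
  apply: le_lt_trans DDhK; apply: le_trans (ler_norm _) _.
  rewrite normrM (ger0_norm (sqr_ge0 _)) ler_pM ?sqr_ge0//.
  by rewrite ler_sqr// nnegrE // (le_trans diam0).
Qed.
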